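(* Let $\mathbf k$ be an algebraically closed field and let $V$ be a $\mathbb Z$-graded vertex $\mathbf k$-algebra with an $\mathrm{Aut}\,\mathcal O$-action. Let $M^1,M^2,M^3$ be $\mathrm{Aut}\,\mathcal O$-equivariant admissible $V$-modules, and assume that the graded components of $M^3$ are all finite-dimensional over $\mathbf k$. Let $S=\mathrm{Spec}\,\mathbf k[z,z^{-1}]$, and over $\mathbb P^1_S\to S$ pick the points $P_\bullet=(0,z,z^{-1})$ and the local coordinates $t_\bullet=(t-z,\,t,\,t^{-1})$ at them. Then every intertwining operator $\mathcal Y(\cdot,z)\in\mathrm{IO}\binom{M^3}{M^1\ M^2}$ given as a map $M^1\otimes M^2\to M^3[[z,z^{-1}]]$ is equivalent to a conformal block $$\Phi\in\mathrm{Hom}\big(\mathbb V(V;M^1,M^2,(M^3)')_{(\mathbb P^1_S\to S,P_\bullet,t_\bullet)},\mathcal O_S\big)$$ such that $\Phi$ is $\mathbf k^\times$-equivariant, by which is meant $$\Phi\big((\Pi^{M^1}(k^{t\partial_t})m^1\otimes\Pi^{M^2}(k^{t\partial_t})m^2\otimes\Pi^{M^3}(k^{t\partial_t})\varphi)\otimes f(z)\big)=\Phi\big((m^1\otimes m^2\otimes\varphi)\otimes f(kz)\big)$$ for all $m^1\in M^1$, $m^2\in M^2$, $\varphi\in(M^3)'$ and $k\in\mathbf k^\times$ (here $f(z)$ is a function on $S$).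
   Context: **Correspondence.** A conformal block $\Phi$, viewed as a map $M^1\otimes M^2\otimes(M^3)'\to\mathbf k[z,z^{-1}]$, is regarded through the pairing $(M^3)'\otimes M^3\to\mathbf k$ as $m^1\otimes m^2\otimes\varphi\mapsto\langle\varphi,\mathcal Y(m^1,z)m^2\rangle$; this is the sense of ''equivalent''. **Vertex algebras.** A vertex $\mathbf k$-algebra is a $\mathbf k$-module $V$ with $\mathbf 1\in V$ and a linear map $Y(\cdot,z)\colon V\to\mathrm{End}(V)[[z,z^{-1}]]$, $Y(a,z)=\sum_{n\in\mathbb Z}a_{(n)}z^{-1-n}$, such that $a_{(n)}b=0$ for $n\gg0$; $\mathbf 1_{(n)}a=\delta_{n,-1}a$; $a_{(-1)}\mathbf 1=a$ and $a_{(n)}\mathbf 1=0$ for $n\ge0$; and the Jacobi identity holds, equivalently for all $r,s\in\mathbb Z$: $[a_{(r)},b_{(s)}]=\sum_{j\ge0}\binom rj(a_{(j)}b)_{(r+s-j)}$ and $(a_{(r)}b)_{(s)}=\sum_{j\ge0}(-1)^j\binom rj\big(a_{(r-j)}b_{(s+j)}-(-1)^rb_{(r+s-j)}a_{(j)}\big)$. Put $T^{(n)}a=a_{(-1-n)}\mathbf 1$ and $e^{zT}=\sum_nz^nT^{(n)}$. $\mathbb Z$-grading: $V=\bigoplus_sV_s$ with $\mathbf 1\in V_0$ and $a_{(n)}$ of degree $\deg a-1-n$; all gradings are lower-truncated ($V_s=0$ for $s\ll0$). For $\Lambda\subset\mathbb Q$ stable under translation by $\mathbb Z$, a $\Lambda$-graded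 $V$-module is $W=\bigoplus_{\ell\in\Lambda}W_\ell$ with modes $a^W_{(n)}$ of degree $\deg a-1-n$, $a^W_{(n)}w=0$ for $n\gg0$, $\mathbf 1^W_{(n)}=\delta_{n,-1}\mathrm{id}$, and the same two formulas. It is admissible if it admits an $\mathbb N$-grading, i.e. such a grading by $\mathbb Z$ vanishing in negative degrees. **$\mathrm{Aut}\,\mathcal O$-actions.** $\mathrm{Aut}\,\mathcal O$ is the group of continuous automorphisms $\rho(t)=a_1t+a_2t^2+\cdots$ ($a_1$ a unit) of $\mathbf k[[t]]$. An action on $V$ is a representation $\Pi\colon\mathrm{Aut}\,\mathcal O\to GL_{\mathbf k}(V)$ such that, with $\Pi(\rho_z)=e^{-zT}\Pi(\rho)e^{\rho(z)T}$ and $G_pV=\bigoplus_{s\le p}V_s$: (i) the coefficients of $\Pi(\rho_z)$ preserve each $G_pV$; (ii) $\Pi(\rho_z)a-(\rho'(z))^{-\Delta}a\in G_{\Delta-1}V[[z]]$ for $a\in V_\Delta$; (iii) $\Pi(x^{t\partial_t})a=x^{-\deg a}a$ for homogeneous $a$, where $x^{t\partial_t}$ is the automorphism $t\mapsto xt$, $x\in\mathbf k^\times$; (iv) $\Pi(\rho)Y(\Pi(\rho_z)^{-1}a,\rho(z))\Pi(\rho)^{-1}=Y(a,z)$. The notions of equivariant module and contragredient presuppose a Möbius structure on $V$: operators $L_{\pm1}^{(n)},L_0^{(n)}$ ($n\ge0$) with $L_i^{(0)}=1$, $L_{-1}^{(n)}=T^{(n)}$, $L_0^{(n)}|_{V_s}=\binom{-2s}n$,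 $L_1^{(n)}$ of degree $-n$, $L_{\pm1}^{(m)}L_{\pm1}^{(n)}=\binom{m+n}nL_{\pm1}^{(m+n)}$, $L_1^{(m)}L_{-1}^{(n)}=\sum_{i=0}^{\min(m,n)}\sum_{j=0}^i\binom{-m-n+2i}{j}(-1)^iL_{-1}^{(n-i)}L_0^{(i-j)}L_1^{(m-i)}$, $L_1^{(n)}\mathbf 1=\delta_{n,0}\mathbf 1$, and $e^{zL_1}Y(a,z_0)e^{-zL_1}=Y\big(e^{z(1-zz_0)L_1}(1-zz_0)^{-2L_0}a,\frac{z_0}{1-zz_0}\big)$, where $e^{zL_{\pm1}}=\sum z^nL_{\pm1}^{(n)}$ and $(1+z)^{-2L_0}=\sum z^nL_0^{(n)}$; for $\gamma(z)=\frac1{1+z}-1$ one has $\Pi(\gamma)a=(-1)^{\deg a}\sum_iL_1^{(i)}a$. An $\mathrm{Aut}\,\mathcal O$-equivariant module $W$ is a lower-truncated $\Lambda$-graded $V$-module with operators $L_{\pm1}^{(n)}$ (of degree $\mp n$) and $L_0^{(n)}|_{W_\ell}=\binom{-2\ell}n$ (denominators of occurring $\ell$ invertible in $\mathbf k$) satisfying the same composition relations, with $e^{zL_{-1}}Y^W(a,x)e^{-zL_{-1}}=Y^W(e^{zL_{-1}}a,x)$ and the analogous $e^{zL_1}$-formula, and with a representation $\Pi^W\colon\mathrm{Aut}\,\mathcal O\to GL_{\mathbf k}(W)$ satisfying the analogues of (i)–(iv): $\Pi^W(\rho_z)=e^{-zT}\Pi^W(\rho)e^{\rho(z)T}$ (with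 $T^{(n)}=L_{-1}^{(n)}$) preserves the filtration and equals $(\rho'(z))^{-\ell}$ on $W_\ell$ modulo lower degree, $\Pi^W(x^{t\partial_t})w=x^{-\ell}w$ for $w\in W_\ell$, and $\Pi^W(\rho)Y^W(\Pi(\rho_z)^{-1}a,\rho(z))\Pi^W(\rho)^{-1}=Y^W(a,z)$. **Contragredient.** $(M^3)'=\bigoplus_\ell\mathrm{Hom}_{\mathbf k}(M^3_\ell,\mathbf k)$ with $\langle Y(a,x)\psi,w\rangle=\langle\psi,Y(e^{xL_1}(-x^{-2})^{L_0}a,x^{-1})w\rangle$. In the equivariance condition, $\Pi^{M^3}(k^{t\partial_t})\varphi$ denotes the action of $k$ on $\varphi\in(M^3)'$ dual to that on $M^3$. **Points and coordinates.** The coordinate $t$ is not the standard parameter of $\mathbb P^1$: $t$ labels the chosen local coordinate at the point $z$, so $t=0$ is the point $z$, and $t-z$ is the formal coordinate shifted to the point $0$; $t^{-1}$ is the coordinate at the point $z^{-1}$. **Coinvariants and conformal blocks.** The complement in $\mathbb P^1_S$ of the three points is identified with $\mathrm{Spec}\,A$, $A=\mathbf k[t,z,t^{-1},z^{-1},(t-z)^{-1}]$, and the chiral Lie algebra with the quotient of $V\otimes A$ by the images of $\partial_t^{(n)}-(-1)^nT^{(n)}$, $n>0$ ($\partial_t^{(n)}$ divided-power derivatives; $a\otimes f$ stands for $a\otimes f\,dt$). It acts on $(M^1\otimes M^2\otimes(M^3)')\otimes\mathcal O_S$ diagonally, by expanding at the three points: with $\iota_{z,t-z},\iota_{z,t},\iota_{t,z}$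 denoting expansion for $t-z$ small relative to $z$, $t$ small relative to $z$, and $z$ small relative to $t$, the element $a\otimes f(t,z)$ acts on $m^1$ by $\mathrm{Res}_{t-z}\,Y(a,t-z)m^1\,\iota_{z,t-z}f\,d(t-z)$, on $m^2$ by $\mathrm{Res}_t\,Y(a,t)m^2\,\iota_{z,t}f\,dt$, and on $\varphi$ by $\langle(a\otimes f)\varphi,w\rangle=-\langle\varphi,\mathrm{Res}_t\,Y(a,t)w\,\iota_{t,z}f\,dt\rangle$. The sheaf of coinvariants $\mathbb V(V;M^1,M^2,(M^3)')_{(\mathbb P^1_S\to S,P_\bullet,t_\bullet)}$ is the cokernel of this action on $(M^1\otimes M^2\otimes(M^3)')\otimes\mathcal O_S$; the sheaf of conformal blocks is its $\mathcal O_S$-dual. **Intertwining operators.** An intertwining operator of type $\binom{M^3}{M^1\ M^2}$, given as a map $M^1\otimes M^2\to M^3[[z,z^{-1}]]$, is a linear map $m^1\otimes m^2\mapsto\mathcal Y(m^1,z)m^2=\sum_{n\in\mathbb Z}m^1_{(n)}m^2\,z^{-1-n}$ such that $m^1_{(n)}m^2=0$ for $n\gg0$ and the Jacobi identity holds for all $a\in V$: with $\delta(x)=\sum_{n\in\mathbb Z}x^n$, $$y^{-1}\delta\Big(\frac{x-z}{y}\Big)Y(a,x)\mathcal Y(m^1,z)m^2-y^{-1}\delta\Big(\frac{-z+x}{y}\Big)\mathcal Y(m^1,z)Y(a,x)m^2=z^{-1}\delta\Big(\frac{x-y}{z}\Big)\mathcal Y(Y(a,y)m^1,z)m^2.$$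
   Formalization: Intertwining operators are additionally required to be graded (m¹_(n) has degree deg m¹−1−n), and equivariance is corrected to Φ(Π(c)(m¹⊗m²⊗φ)⊗f(cz)) = Φ((m¹⊗m²⊗φ)⊗f)(cz), as the displayed formula forces Φ=0. *)

(* Defs.v *)
From HB Require Import structures.
From mathcomp Require Import all_boot all_order all_algebra.
From mathcomp Require Import all_classical.
From mathcomp Require Import ring.

Set Implicit Arguments.
Unset Strict Implicit.
Unset Printing Implicit Defensive.
Import Order.TTheory GRing.Theory Num.Theory.
Local Open Scope ring_scope.

(* F is finitely supported and its values add up to s *)
Definition has_sum (I : eqType) (W : zmodType) (F : I -> W) (s : W) : Prop :=
  exists r : seq I,
    [/\ uniq r, forall i, i \notin r -> F i = 0 & s = \sum_(i <- r) F i].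

Section FreeModule.
Variables (T : choiceType) (R : comNzRingType).

Definition fin_supp : pred (T -> R^o) :=
  fun f => `[< exists r : seq T, forall x, x \notin r -> f x = 0 >].

Fact fin_supp_submod : submod_closed fin_supp.
Proof.
split; first by apply/asboolP; exists [::].
move=> c f g /asboolP[r fr] /asboolP[s gs]; apply/asboolP; exists (r ++ s) => x.
rewrite mem_cat negb_or => /andP[xr xs].
by rewrite /GRing.add/= /GRing.scale/= fr// gs// scaler0 addr0.
Qed.
HB.instance Definition _ :=
  GRing.isSubmodClosed.Build R (T -> R^o) fin_supp fin_supp_submod.

Record freemod := FreeMod { fm_fun :> T -> R^o; fm_supp : fm_fun \in fin_supp }.
HB.instance Definition _ := [isSub for fm_fun].
HB.instance Definition _ := [Choice of freemod by <:].
HB.instance Definition _ := [SubChoice_isSubLmodule of freemod by <:].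

Fact fgen_supp (x : T) : (fun y => (y == x)%:R : R^o) \in fin_supp.
Proof. by apply/asboolP; exists [:: x] => y; rewrite inE => /negPf ->. Qed.
Definition fgen (x : T) : freemod := FreeMod (fgen_supp x).

End FreeModule.

(* U modulo the R-submodule spanned by G *)
Section SpanQuotient.
Variables (R : comNzRingType) (U : lmodType R) (G : set U).

Definition span_of : {pred U} :=
  fun x => `[< exists s : seq (R * U), (forall p, p \in s -> G p.2) /\
                 x = \sum_(p <- s) p.1 *: p.2 >].

Fact span_of_submod : submod_closed span_of.
Proof.
split; first by apply/asboolP; exists [::]; split=> //; rewrite big_nil.
move=> c x y /asboolP[s [Gs ->]] /asboolP[t [Gt ->]]; apply/asboolP.
exists ([seq (c * p.1, p.2) | p <- s] ++ t); split.
  move=> p; rewrite mem_cat => /orP[/mapP[q qs ->]|]; first exact: Gs q qs.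
  exact: Gt.
rewrite big_cat big_map/= scaler_sumr; congr (_ + _).
by apply: eq_bigr => p _; rewrite scalerA.
Qed.
HB.instance Definition _ :=
  GRing.isSubmodClosed.Build R U span_of span_of_submod.

Local Open Scope quotient_scope.

Definition span_zmod : zmodClosed U := span_of.

Definition quot_span : Type := Quotient.quot span_zmod.
HB.instance Definition _ := GRing.Zmodule.on quot_span.
HB.instance Definition _ := EqQuotient.on quot_span.

Definition qproj (x : U) : quot_span := \pi_(Quotient.quot span_zmod) x.

Definition qscale (c : R) (x : quot_span) : quot_span := qproj (c *: repr x).

Fact qprojE x y : (qproj x == qproj y) = (x - y \in span_of).
Proof. by rewrite Quotient.idealrBE. Qed.

Fact qproj_surj (x : quot_span) : qproj (repr x) = x.
Proof. exact: reprK. Qed.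

Fact qscaleE c x : qscale c (qproj x) = qproj (c *: x).
Proof.
apply/eqP; rewrite qprojE -scalerBr; apply: rpredZ.
by rewrite -qprojE qproj_surj.
Qed.

Fact qscaleA a b x : qscale a (qscale b x) = qscale (a * b) x.
Proof. by rewrite -(qproj_surj x) !qscaleE scalerA. Qed.
Fact qscale1 : left_id 1 qscale.
Proof. by move=> x; rewrite -(qproj_surj x) qscaleE scale1r. Qed.
Fact qprojD x y : qproj (x + y) = qproj x + qproj y.
Proof. exact: (raddfD (\pi_(Quotient.quot span_zmod))). Qed.
Fact qscaleDr : right_distributive qscale +%R.
Proof.
move=> c x y; rewrite -(qproj_surj x) -(qproj_surj y) -qprojD !qscaleE.
by rewrite scalerDr qprojD.
Qed.
Fact qscaleDl x : {morph qscale^~ x : a b / a + b}.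
Proof.
by move=> a b /=; rewrite -(qproj_surj x) !qscaleE scalerDl qprojD.
Qed.
HB.instance Definition _ :=
  GRing.Zmodule_isLmodule.Build R quot_span qscaleA qscale1 qscaleDr qscaleDl.

Fact qproj_linear : linear qproj.
Proof. by move=> c x y; rewrite qprojD -qscaleE. Qed.
HB.instance Definition _ :=
  GRing.isLinear.Build R U quot_span _ qproj qproj_linear.

End SpanQuotient.

Section Laurent.
Variable k : closedFieldType.

Definition laurent : Type := freemod int k.
HB.instance Definition _ := GRing.Lmodule.on laurent.

Implicit Types f g h : laurent.

Definition lcoef f (n : int) : k := (f : freemod int k) n.
Arguments lcoef : simpl never.

Definition lconv f g (n : int) : k := \sum_(i \in [set: int]) lcoef f i * lcoef g (n - i).

Fact lcoefP f : exists r : seq int, uniq r /\ forall i, i \notin r -> lcoef f i = 0.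
Proof.
have /asboolP[r rP] := fm_supp f; exists (undup r); rewrite undup_uniq.
by split=> // i; rewrite mem_undup; exact: rP.
Qed.

Fact lconvE f g n (r : seq int) : uniq r -> (forall i, i \notin r -> lcoef f i = 0) ->
  lconv f g n = \sum_(i <- r) lcoef f i * lcoef g (n - i).
Proof.
move=> ur rP; rewrite /lconv (fsbigE r)//.
  by apply: eq_bigl => i; rewrite in_setT.
by move=> i _ /rP ->; rewrite mul0r.
Qed.

Fact lconvC f g n : lconv f g n = lconv g f n.
Proof.
rewrite /lconv (reindex_fsbigT (fun i => n - i))/=.
  by apply: eq_fsbigr => i _; rewrite subKr mulrC.
by exists (fun i => n - i) => i; rewrite subKr.
Qed.

Fact lconv_supp f g : (lconv f g : int -> k^o) \in @fin_supp int k.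
Proof.
have [r [ur rP]] := lcoefP f; have [s [us sP]] := lcoefP g.
apply/asboolP; exists [seq i + j | i <- r, j <- s] => n nrs.
rewrite (lconvE _ _ ur rP) big_seq big1// => i ir; rewrite sP ?mulr0//.
apply: contra nrs => js; apply/allpairsP; exists (i, n - i); split=> //=.
by rewrite addrC subrK.
Qed.

Definition lmul f g : laurent := FreeMod (lconv_supp f g).
(* c z^n *)
Definition lmono (c : k) (n : int) : laurent := c *: fgen k n.

Fact lcoef_mul f g n : lcoef (lmul f g) n = lconv f g n. Proof. by []. Qed.
Fact lcoefD f g n : lcoef (f + g) n = lcoef f n + lcoef g n. Proof. by []. Qed.
Fact lcoef_mono c m n : lcoef (lmono c m) n = if n == m then c else 0.
Proof.
by rewrite -[LHS]/(c * (n == m)%:R); case: eqP; rewrite ?mulr1 ?mulr0.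
Qed.
Fact laurentP f g : (forall n, lcoef f n = lcoef g n) -> f = g.
Proof. by move=> fg; apply/val_inj/funext. Qed.

Fact lmulC : commutative lmul.
Proof. by move=> f g; apply: laurentP => n; rewrite !lcoef_mul lconvC. Qed.

Fact lmulCA f g h : lmul f (lmul g h) = lmul g (lmul f h).
Proof.
have [r [ur rP]] := lcoefP f; have [s [us sP]] := lcoefP g.
apply: laurentP => n; rewrite !lcoef_mul (lconvE _ _ ur rP) (lconvE _ _ us sP).
under eq_bigr => i _ do rewrite lcoef_mul (lconvE _ _ us sP) mulr_sumr.
under [RHS]eq_bigr => i _ do rewrite lcoef_mul (lconvE _ _ ur rP) mulr_sumr.
rewrite exchange_big/=; apply: eq_bigr => j _; apply: eq_bigr => i _.
by rewrite mulrCA addrAC.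
Qed.
Fact lmulA : associative lmul.
Proof. by move=> f g h; rewrite [RHS]lmulC [RHS]lmulCA (lmulC h). Qed.
Fact lmul1 : left_id (lmono 1 0) lmul.
Proof.
move=> f; apply: laurentP => n; rewrite lcoef_mul (@lconvE _ _ _ [:: 0])//.
  by rewrite big_seq1 lcoef_mono eqxx mul1r subr0.
by move=> i; rewrite inE lcoef_mono => /negPf ->.
Qed.
Fact lmulDl : left_distributive lmul +%R.
Proof.
move=> f g h; rewrite !(lmulC _ h).
have [r [ur rP]] := lcoefP h; apply: laurentP => n.
rewrite lcoefD !lcoef_mul !(lconvE _ _ ur rP) -big_split/=.
by apply: eq_bigr => i _; rewrite lcoefD mulrDr.
Qed.
Fact lone_neq0 : lmono 1 0 != 0.
Proof.
apply/eqP => /(congr1 (lcoef^~ 0)); rewrite lcoef_mono eqxx => /eqP.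
by rewrite oner_eq0.
Qed.
HB.instance Definition _ := GRing.Zmodule_isComNzRing.Build laurent
  lmulA lmulC lmul1 lmulDl lone_neq0.

Fact lscale_supp (c : k) (f : laurent) :
  (fun n : int => c ^ n * lcoef f n : k^o) \in @fin_supp int k.
Proof.
have [r [_ rP]] := lcoefP f; apply/asboolP; exists r => n /rP ->.
by rewrite mulr0.
Qed.
(* f(z) |-> f(cz) *)
Definition lscale (c : k) (f : laurent) : laurent := FreeMod (lscale_supp c f).
End Laurent.

Section Series.
Variable k : closedFieldType.

(* The image in k of the rational number q(q-1)...(q-n+1)/n!, which only
   involves primes of the denominator of q in its own denominator. *)
Definition qbinom (q : rat) (n : nat) : k :=
  ratr ((\prod_(i < n) (q - i%:R)) / n`!%:R).
Definition zbinom (m : int) (n : nat) : k := qbinom m%:~R n.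

(* A power series sum_i f_i t^i is represented by its coefficients
   f : nat -> k. *)

(* coefficient of t^m in f^n *)
Definition ps_exp (f : nat -> k) (n m : nat) : k :=
  ((\poly_(i < m.+1) f i) ^+ n)`_m.

(* g(f(t)), for f without constant term *)
Definition ps_comp (g f : nat -> k) (m : nat) : k :=
  \sum_(n < m.+1) g n * ps_exp f n m.

Definition ps_deriv (f : nat -> k) (n : nat) : k := f n.+1 *+ n.+1.

(* y is a value of x^q *)
Definition is_rpow (x : k) (q : rat) (y : k) : Prop := y ^ denq q = x ^ numq q.

(* f^q = y (1 + v)^q where f = f_0 (1 + v), f_0 != 0, and y is a value of
   f_0^q *)
Definition ps_rpow (y : k) (q : rat) (f : nat -> k) (m : nat) : k :=
  let v i := if i is 0%N then 0 else f i / f 0%N in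
  y * \sum_(j < m.+1) qbinom q j * ps_exp v j m.

(* coefficient of z^M in f(z)^m, for f = f_1 z + f_2 z^2 + ... with f_1 != 0:
   f^m = z^m (f_1 + f_2 z + ...)^m *)
Definition ps_zpow (f : nat -> k) (m M : int) : k :=
  if M - m is Posz N
  then ps_rpow (f 1%N ^ m) m%:~R (fun i => f i.+1) N else 0.

Record autO := AutO {
  aut_ser :> nat -> k;
  aut_serP : (aut_ser 0 == 0) && (aut_ser 1 != 0) }.

Fact autO_mul_subproof (rho mu : autO) :
  (ps_comp mu rho 0 == 0) && (ps_comp mu rho 1 != 0).
Proof.
have /andP[/eqP r0 r1] := aut_serP rho; have /andP[/eqP m0 m1] := aut_serP mu.
rewrite /ps_comp /ps_exp !big_ord_recr !big_ord0 /= m0 !mul0r !add0r eqxx /=.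
by rewrite expr1 coef_poly mulf_neq0.
Qed.

(* rho stands for the automorphism f(t) |-> f(rho(t)); the composite of rho
   after mu sends t to mu(rho(t)). *)
Definition autO_mul (rho mu : autO) : autO := AutO (autO_mul_subproof rho mu).

Fact autO_scale_subproof (x : k) (x0 : x != 0) :
  let f i := if i == 1%N then x else 0 in (f 0%N == 0) && (f 1%N != 0).
Proof. by rewrite /= eqxx. Qed.

(* the automorphism t |-> x t *)
Definition autO_scale (x : k) (x0 : x != 0) : autO :=
  AutO (autO_scale_subproof x0).

Definition autO_one : autO := autO_scale (oner_neq0 k).

Fact autO_gamma_subproof :
  let f i : k := if i is 0%N then 0 else (-1) ^+ i in
  (f 0%N == 0) && (f 1%N != 0).
Proof. by rewrite /= eqxx expr1 oppr_eq0 oner_neq0. Qed.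

(* 1/(1+t) - 1 *)
Definition autO_gamma : autO := AutO autO_gamma_subproof.

End Series.

Section Structures.
Variable k : closedFieldType.

(* A grading of W by a subset Lam of the rationals, given by its projections
   gr l : W -> W_l; all gradings are lower-truncated. *)
Record grading (W : lmodType k) (Lam : set rat) (gr : rat -> W -> W) : Prop := {
  gr_linear : forall l, linear (gr l);
  gr_proj : forall l m w, gr l (gr m w) = if l == m then gr m w else 0;
  gr_sum : forall w, has_sum (gr^~ w) w;
  gr_index : forall l w, ~ Lam l -> gr l w = 0;
  gr_trunc : exists b : rat, forall l w, l < b -> gr l w = 0 }.

Definition homog (W : lmodType k) (gr : rat -> W -> W) (l : rat) (w : W) : Prop :=
  gr l w = w.

(* w lies in the sum of the W_m, m <= l *)
Definition in_filt (W : lmodType k) (gr : rat -> W -> W) (l : rat) (w : W) : Prop :=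
  forall m, l < m -> gr m w = 0.

(* w lies in the sum of the W_m, m < l *)
Definition in_lower (W : lmodType k) (gr : rat -> W -> W) (l : rat) (w : W) : Prop :=
  forall m, l <= m -> gr m w = 0.

Definition integers : set rat := [set l | l \is a Num.int].

Definition translation_stable (Lam : set rat) : Prop :=
  forall l (m : int), Lam l -> Lam (l + m%:~R).

(* An action of V (with vacuum one and modes Y a n = a_(n)) on W by modes
   YW a n; for W = V these are the vertex algebra axioms, except for
   a_(n) one. *)
Record mode_action (V W : lmodType k) (one : V) (Y : V -> int -> V -> V)
    (YW : V -> int -> W -> W) : Prop := {
  ma_linear_l : forall n w, linear (fun a => YW a n w);
  ma_linear_r : forall a n, linear (YW a n);
  ma_trunc : forall a w, exists N : int, forall n, N <= n -> YW a n w = 0;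
  ma_vacuum : forall n w, YW one n w = if n == -1 then w else 0;
  ma_commutator : forall a b w (r s : int),
    has_sum (fun j : nat => zbinom k r j *: YW (Y a j b) (r + s - j%:Z) w)
      (YW a r (YW b s w) - YW b s (YW a r w));
  ma_iterate : forall a b w (r s : int),
    has_sum (fun j : nat => ((-1) ^+ j * zbinom k r j) *:
               (YW a (r - j%:Z) (YW b (s + j%:Z) w)
                - (-1) ^ r *: YW b (r + s - j%:Z) (YW a j w)))
      (YW (Y a r b) s w) }.

(* a_(n) has degree deg a - 1 - n *)
Definition mode_degree (V W : lmodType k) (grV : rat -> V -> V)
    (grW : rat -> W -> W) (YW : V -> int -> W -> W) : Prop :=
  forall s l a n w, homog grV s a -> homog grW l w ->
    homog grW (s + l - 1 - n%:~R) (YW a n w).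

Record vertexAlgebra := VertexAlgebra {
  va_car :> lmodType k;
  va_one : va_car;
  va_mode : va_car -> int -> va_car -> va_car;
  va_gr : rat -> va_car -> va_car;
  va_action : mode_action va_one va_mode va_mode;
  va_creation : forall a, va_mode a (-1) va_one = a;
  va_creation0 : forall a n, 0 <= n -> va_mode a n va_one = 0;
  va_grading : grading integers va_gr;
  va_one_degree : homog va_gr 0 va_one;
  va_mode_degree : mode_degree va_gr va_gr va_mode }.

(* T^(n) *)
Definition va_T (V : vertexAlgebra) (n : nat) (a : V) : V :=
  va_mode a (-1 - n%:Z) (va_one V).

(* The relations between Lm n = L_{-1}^(n), L0 n = L_0^(n), Lp n = L_1^(n). *)
Record moebius_relations (W : lmodType k) (gr : rat -> W -> W)
    (Lm L0 Lp : nat -> W -> W) : Prop := {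
  mr_linear : forall n, [/\ linear (Lm n), linear (L0 n) & linear (Lp n)];
  mr_0 : forall w, [/\ Lm 0%N w = w, L0 0%N w = w & Lp 0%N w = w];
  mr_Lm_degree : forall n l w, homog gr l w -> homog gr (l + n%:R) (Lm n w);
  mr_Lp_degree : forall n l w, homog gr l w -> homog gr (l - n%:R) (Lp n w);
  mr_L0 : forall n l w, homog gr l w -> L0 n w = qbinom k (- 2 * l) n *: w;
  mr_LmLm : forall m n w, Lm m (Lm n w) = 'C(m + n, n)%:R *: Lm (m + n)%N w;
  mr_LpLp : forall m n w, Lp m (Lp n w) = 'C(m + n, n)%:R *: Lp (m + n)%N w;
  mr_LpLm : forall m n w, Lp m (Lm n w) =
    \sum_(i < (minn m n).+1) \sum_(j < i.+1)
      (zbinom k (- m%:Z - n%:Z + (2 * i)%:Z) j * (-1) ^+ i) *: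
        Lm (n - i)%N (L0 (i - j)%N (Lp (m - i)%N w)) }.

(* e^{z L_1} Y(a,z_0) e^{-z L_1} =
     Y(e^{z(1 - z z_0) L_1} (1 - z z_0)^{-2 L_0} a, z_0 / (1 - z z_0)):
   coefficient of z^p z_0^{-1-n} applied to w. On the right, L_1^(i) L_0^(r) a
   comes with z^i (1 - z z_0)^i (- z z_0)^r, and its mode m with
   z_0^{-1-m} (1 - z z_0)^{1+m}; the terms with i + q + r = p and
   m = n + q + r contribute, q being the exponent of z z_0 taken from
   (1 - z z_0)^{i+1+m}. *)
Definition L1_covariant (V W : lmodType k) (YW : V -> int -> W -> W)
    (L0 Lp : nat -> V -> V) (LpW : nat -> W -> W) : Prop :=
  forall (a : V) (w : W) (p : nat) (n : int),
    \sum_(i < p.+1) (-1) ^+ (p - i) *: LpW i (YW a n (LpW (p - i)%N w)) =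
    \sum_(i < p.+1) \sum_(q < (p - i).+1)
      let r := (p - i - q)%N in let m := n + q%:Z + r%:Z in
      ((-1) ^+ (q + r) * zbinom k (i%:Z + 1 + m) q) *:
        YW (Lp i (L0 r a)) m w.

Record moebiusStructure (V : vertexAlgebra) := MoebiusStructure {
  mo_L0 : nat -> V -> V;
  mo_L1 : nat -> V -> V;
  mo_relations : moebius_relations (@va_gr V) (@va_T V) mo_L0 mo_L1;
  mo_L1_one : forall n, mo_L1 n (va_one V) = if n == 0%N then va_one V else 0;
  mo_L1_covariant : L1_covariant (@va_mode V) mo_L0 mo_L1 mo_L1 }.

Section AutOAction.
Variables (W : lmodType k) (gr : rat -> W -> W) (Lm : nat -> W -> W).
(* P rho = Pi(rho), PV rho = Pi(rho)^{-1} *)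
Variables (P PV : autO k -> W -> W).

(* coefficient of z^N in Pi(rho_z) w = e^{-zT} Pi(rho) e^{rho(z)T} w *)
Definition Pi_z (rho : autO k) (N : nat) (w : W) : W :=
  \sum_(i < N.+1) (-1) ^+ i *:
    Lm i (P rho (\sum_(n < (N - i).+1) ps_exp rho n (N - i) *: Lm n w)).

(* coefficient of z^N in Pi(rho_z)^{-1} w = e^{-rho(z)T} Pi(rho)^{-1} e^{zT} w *)
Definition Pi_z_inv (rho : autO k) (N : nat) (w : W) : W :=
  \sum_(i < N.+1) \sum_(n < (N - i).+1)
    ((-1) ^+ n * ps_exp rho n (N - i)) *: Lm n (PV rho (Lm i w)).

(* A representation of Aut O on W with properties (i)-(iii). For a non-integral
   degree l, x^{-l} and (rho'(z))^{-l} are values of the multivalued power; for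
   integral l, is_rpow x (- l) y just says that y = x^{-l}. *)
Record autO_rep : Prop := {
  ar_linear : forall rho, linear (P rho);
  ar_inv : forall rho, cancel (P rho) (PV rho) /\ cancel (PV rho) (P rho);
  ar_one : forall w, P (autO_one k) w = w;
  ar_mul : forall rho mu w, P (autO_mul rho mu) w = P rho (P mu w);
  ar_filt : forall (rho : autO k) N l w, in_filt gr l w -> in_filt gr l (Pi_z rho N w);
  ar_symbol : forall (rho : autO k) (l : rat), exists y, is_rpow (rho 1%N) (- l) y /\
    forall w N, homog gr l w ->
      in_lower gr l (Pi_z rho N w - ps_rpow y (- l) (ps_deriv rho) N *: w);
  ar_scale : forall (x : k) (x0 : x != 0) (l : rat), exists y, is_rpow x (- l) y /\
    forall w, homog gr l w -> P (autO_scale x0) w = y *: w }.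

End AutOAction.

(* Pi^W(rho) Y^W(Pi(rho_z)^{-1} a, rho(z)) Pi^W(rho)^{-1} w = Y^W(a,z) w:
   coefficient of z^M. With b_N = Pi_z_inv rho N a, the left-hand side is the sum
   over N and n of z^N rho(z)^{-1-n} Pi^W(rho) (b_N)_(n) Pi^W(rho)^{-1} w. *)
Definition autO_covariant (V W : lmodType k) (YW : V -> int -> W -> W)
    (LmV : nat -> V -> V) (PVinv : autO k -> V -> V)
    (PW PWinv : autO k -> W -> W) : Prop :=
  forall (rho : autO k) (a : V) (w : W) (M : int),
    has_sum (fun x : nat * int =>
      ps_zpow rho (-1 - x.2) (M - x.1%:Z) *:
        PW rho (YW (Pi_z_inv LmV PVinv rho x.1 a) x.2 (PWinv rho w)))
      (YW a (-1 - M) w).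

Record autOAction (V : vertexAlgebra) (mo : moebiusStructure V) := AutOAction {
  ac_Pi : autO k -> V -> V;
  ac_Pi_inv : autO k -> V -> V;
  ac_rep : autO_rep (@va_gr V) (@va_T V) ac_Pi ac_Pi_inv;
  ac_covariant :
    autO_covariant (@va_mode V) (@va_T V) ac_Pi_inv ac_Pi ac_Pi_inv;
  (* Pi(1/(1+t) - 1) a = (-1)^{deg a} sum_i L_1^(i) a *)
  ac_gamma : forall (s : int) a, homog (@va_gr V) s%:~R a ->
    has_sum (fun i => (-1) ^ s *: mo_L1 mo i a) (ac_Pi (autO_gamma k) a) }.

Record equivariantModule (V : vertexAlgebra) (mo : moebiusStructure V)
    (ac : autOAction mo) := EquivariantModule {
  em_car :> lmodType k;
  em_Lambda : set rat;
  em_gr : rat -> em_car -> em_car;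
  em_mode : V -> int -> em_car -> em_car;
  em_Lm1 : nat -> em_car -> em_car;
  em_L0 : nat -> em_car -> em_car;
  em_L1 : nat -> em_car -> em_car;
  em_Pi : autO k -> em_car -> em_car;
  em_Pi_inv : autO k -> em_car -> em_car;
  em_stable : translation_stable em_Lambda;
  em_grading : grading em_Lambda em_gr;
  em_action : mode_action (va_one V) (@va_mode V) em_mode;
  em_mode_degree : mode_degree (@va_gr V) em_gr em_mode;
  em_denominators : forall l w, homog em_gr l w -> w != 0 ->
    (denq l)%:~R != 0 :> k;
  em_relations : moebius_relations em_gr em_Lm1 em_L0 em_L1;
  em_Lm1_covariant : forall a w (p : nat) (n : int),
    \sum_(i < p.+1) (-1) ^+ (p - i) *:
      em_Lm1 i (em_mode a n (em_Lm1 (p - i)%N w)) = em_mode (va_T p a) n w;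
  em_L1_covariant : L1_covariant em_mode (mo_L0 mo) (mo_L1 mo) em_L1;
  em_rep : autO_rep em_gr em_Lm1 em_Pi em_Pi_inv;
  em_covariant :
    autO_covariant em_mode (@va_T V) (ac_Pi_inv ac) em_Pi em_Pi_inv }.

End Structures.

Section Modules.
Variables (k : closedFieldType) (V : vertexAlgebra k).
Variables (mo : moebiusStructure V) (ac : autOAction mo).

Definition admissible (M : equivariantModule ac) : Prop :=
  exists gr : rat -> M -> M,
    [/\ grading integers gr, mode_degree (@va_gr k V) gr (@em_mode _ _ _ _ M)
      & forall l w, l < 0 -> gr l w = 0].

Definition finite_dim_components (M : equivariantModule ac) : Prop :=
  forall l, exists (n : nat) (b : 'I_n -> M), forall w,
    homog (@em_gr _ _ _ _ M) l w -> exists c : 'I_n -> k, w = \sum_i c i *: b i.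

(* M' = sum over l of Hom(M_l, k), realized as the linear forms on M that vanish
   on all but finitely many M_l *)
Section Contragredient.
Variable M : equivariantModule ac.

Definition graded_form : {pred M -> k^o} :=
  fun phi => `[< linear phi /\ exists r : seq rat,
    forall l w, l \notin r -> phi (em_gr l w) = 0 >].

Fact graded_form_submod : submod_closed graded_form.
Proof.
split.
  apply/asboolP; split; last by exists [::].
  by move=> c u v; rewrite /GRing.zero/= scaler0 addr0.
move=> c f g /asboolP[fl [r rP]] /asboolP[gl [s sP]]; apply/asboolP; split.
  move=> d u v; rewrite -[LHS]/(c *: f (d *: u + v) + g (d *: u + v)) fl gl.
  rewrite -[X in _ = _ *: X + _]/(c *: f u + g u).
  rewrite -[X in _ = _ + X]/(c *: f v + g v).
  by rewrite !scalerDr !scalerA (mulrC c d) addrACA.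
exists (r ++ s) => l w; rewrite mem_cat negb_or => /andP[lr ls].
rewrite -[LHS]/(c *: f (em_gr l w) + g (em_gr l w)) rP// sP//.
by rewrite scaler0 addr0.
Qed.
HB.instance Definition _ :=
  GRing.isSubmodClosed.Build k (M -> k^o) graded_form graded_form_submod.

Record contragredient := Contragredient {
  cg_fun :> M -> k^o; cg_funP : cg_fun \in graded_form }.
HB.instance Definition _ := [isSub for cg_fun].
HB.instance Definition _ := [Choice of contragredient by <:].
HB.instance Definition _ := [SubChoice_isSubLmodule of contragredient by <:].

Implicit Type phi : contragredient.

Fact cg_linear phi : linear phi.
Proof. by have /asboolP[] := cg_funP phi. Qed.

Fact cg_big phi (I : Type) (r : seq I) (F : I -> M) :
  phi (\sum_(i <- r) F i) = \sum_(i <- r) phi (F i).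
Proof.
have phiD u v : phi (u + v) = phi u + phi v.
  by have := cg_linear phi 1 u v; rewrite !scale1r.
have phi0 : phi 0 = 0 by apply: (addrI (phi 0)); rewrite -phiD !addr0.
by elim/big_rec2: _ => // i x y _ <-; rewrite phiD.
Qed.

Fact cg_mode_subproof (a : V) (n : int) phi :
  (fun w => phi (em_mode a n w) : k^o) \in graded_form.
Proof.
have /asboolP[_ [r rP]] := cg_funP phi.
have [sa [_ _ aE]] := gr_sum (va_grading V) a.
apply/asboolP; split=> [c u v|].
  by rewrite (ma_linear_r (em_action M)) cg_linear.
exists [seq m - s + 1 + n%:~R | m <- r, s <- sa] => l w lr.
have modeD u v x : @em_mode _ _ _ _ M (u + v) n x = em_mode u n x + em_mode v n x.
  by have := ma_linear_l (em_action M) n x 1 u v; rewrite !scale1r.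
have mode0 x : @em_mode _ _ _ _ M 0 n x = 0.
  by apply: (addrI (em_mode 0 n x)); rewrite -modeD !addr0.
have -> : em_mode a n (em_gr l w) =
          \sum_(s <- sa) em_mode (va_gr s a) n (em_gr l w).
  by rewrite {1}aE; elim/big_rec2: _ => // s x y _ <-; rewrite modeD.
rewrite cg_big big_seq big1// => s ssa.
have hd : homog (@em_gr _ _ _ _ M) (s + l - 1 - n%:~R)
                (em_mode (va_gr s a) n (em_gr l w)).
  apply: em_mode_degree.
    by rewrite /homog (gr_proj (va_grading V)) eqxx.
  by rewrite /homog (gr_proj (em_grading M)) eqxx.
rewrite -hd; apply: rP; apply: contra lr => dr.
apply/allpairsP; exists (s + l - 1 - n%:~R, s); split=> //=.
ring.
Qed.

(* w |-> phi(a_(n) w) *)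
Definition cg_mode (a : V) (n : int) phi : contragredient :=
  Contragredient (cg_mode_subproof a n phi).

Fact cg_scale_subproof (x : k) (x0 : x != 0) phi :
  (fun w => phi (em_Pi_inv (autO_scale x0) w) : k^o) \in graded_form.
Proof.
have /asboolP[_ [r rP]] := cg_funP phi.
have rep := em_rep M; have Plin := ar_linear rep (autO_scale x0).
have [PK PVK] := ar_inv rep (autO_scale x0).
have phiZ c u : phi (c *: u) = c *: phi u.
  have phi0 : phi 0 = 0 by have := cg_linear phi (-1) 0 0; rewrite scaleN1r addNr scaleN1r addNr.
  by have := cg_linear phi c u 0; rewrite !addr0 phi0 addr0.
have PVlin : linear (@em_Pi_inv _ _ _ _ M (autO_scale x0)).
  by move=> c u v; apply: (can_inj PK); rewrite Plin !PVK.
apply/asboolP; split=> [c u v|]; first by rewrite PVlin cg_linear.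
exists r => l w lr.
have [y [yP yE]] := ar_scale rep x0 l.
have y0 : y != 0.
  apply: contraTneq (expfz_neq0 (numq (- l)) x0) => y0.
  by rewrite negbK -yP y0 exp0rz denq_eq0.
have -> : em_Pi_inv (autO_scale x0) (em_gr l w) = y^-1 *: em_gr l w.
  apply: (can_inj PK); rewrite PVK yE.
    by rewrite scalerA divff ?scale1r.
  rewrite /homog.
  have := gr_linear (em_grading M) l y^-1 (em_gr l w) 0.
  have g0 : em_gr l 0 = 0 :> M.
    by have := gr_linear (em_grading M) l (-1) 0 0; rewrite scaleN1r addNr scaleN1r addNr.
  by rewrite !addr0 g0 addr0 (gr_proj (em_grading M)) eqxx.
by rewrite phiZ rP// scaler0.
Qed.

(* the action of t |-> x t on M' dual to the one on M *)
Definition cg_scale (x : k) (x0 : x != 0) phi : contragredient :=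
  Contragredient (cg_scale_subproof x0 phi).

End Contragredient.

(* An element of A = k[t, z, t^-1, z^-1, (t-z)^-1], as a list of terms
   c t^i z^j (t-z)^l, written (c, i, j, l). The three expansions below depend
   only on the element and not on how it is written. *)
Definition A_elt : Type := seq (k * int * int * int).

(* coefficient of (t-z)^n in iota_{z,t-z} g *)
Definition iota_z_tz (g : A_elt) (n : int) : laurent k :=
  \sum_(x <- g) let: (c, i, j, l) := x in
    if n - l is Posz e then lmono (c * zbinom k i e) (i - e%:Z + j) else 0.

(* coefficient of t^n in iota_{z,t} g *)
Definition iota_z_t (g : A_elt) (n : int) : laurent k :=
  \sum_(x <- g) let: (c, i, j, l) := x in
    if n - i is Posz e
    then lmono (c * (zbinom k l e * (-1) ^ (l - e%:Z))) (j + l - e%:Z) else 0.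

(* coefficient of t^n in iota_{t,z} g *)
Definition iota_t_z (g : A_elt) (n : int) : laurent k :=
  \sum_(x <- g) let: (c, i, j, l) := x in
    if i + l - n is Posz e
    then lmono (c * (zbinom k l e * (-1) ^+ e)) (j + e%:Z) else 0.

Section ConformalBlocks.
Variables M1 M2 M3 : equivariantModule ac.

Let M3' := contragredient M3.
Let OS := laurent k.
Let free_triples := freemod (M1 * M2 * M3')%type OS.

Definition triple (m1 : M1) (m2 : M2) (phi : M3') : free_triples :=
  fgen OS (m1, m2, phi).

Definition trilinearity : set free_triples :=
  [set x | exists (c : k) (m1 m1' : M1) (m2 m2' : M2) (phi phi' : M3'),
    [\/ x = triple (c *: m1 + m1') m2 phi
             - lmono c 0 *: triple m1 m2 phi - triple m1' m2 phi,
         x = triple m1 (c *: m2 + m2') phi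
             - lmono c 0 *: triple m1 m2 phi - triple m1 m2' phi
       | x = triple m1 m2 (c *: phi + phi')
             - lmono c 0 *: triple m1 m2 phi - triple m1 m2 phi'] ].

(* (M1 (x) M2 (x) M3') (x)_k O_S, as an O_S-module *)
Definition tensor : lmodType OS := quot_span trilinearity.

Definition tens (m1 : M1) (m2 : M2) (phi : M3') (f : OS) : tensor :=
  qproj trilinearity (f *: triple m1 m2 phi).

(* x = (a (x) g) (m1 (x) m2 (x) phi). All but finitely many terms of the sum
   vanish: a_(n) m1, a_(n) m2 and iota_t_z g n for n large, the two other
   expansions and phi o a_(n) for n small. The action being O_S-linear, these
   x span its image; the relations divided out of V (x) A in the chiral Lie
   algebra act by zero. *)
Definition chiral_action (a : V) (g : A_elt) (m1 : M1) (m2 : M2) (phi : M3')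
    (x : tensor) : Prop :=
  has_sum (fun n : int =>
    tens (em_mode a n m1) m2 phi (iota_z_tz g n)
    + tens m1 (em_mode a n m2) phi (iota_z_t g n)
    - tens m1 m2 (cg_mode a n phi) (iota_t_z g n)) x.

Definition coinvariants : lmodType OS :=
  quot_span [set x | exists a g m1 m2 phi, chiral_action a g m1 m2 phi x].

Definition coinv (m1 : M1) (m2 : M2) (phi : M3') (f : OS) : coinvariants :=
  qproj _ (tens m1 m2 phi f).

Definition conformal_block : Type := {linear coinvariants -> OS^o}.

(* YI m1 n m2 is the mode m1_(n) m2. An intertwining operator of graded modules is
   graded: m1_(n) has degree deg m1 - 1 - n. Truncation and the Jacobi identity
   alone allow multiplication by any power series p(z), after which
   <phi, Y(m1,z) m2> need not be a Laurent polynomial.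
   The Jacobi identity is the equality of the coefficients of
   x^{-1-p} y^{-1-l} z^{-1-q}: (x-z)^l and (-z+x)^l are expanded in nonnegative
   powers of the second variable, and z^{-1} delta((x-y)/z) is the sum over n of
   (x-y)^n z^{-1-n}, whose term in y^i contributes for n = i-1-p. *)
Record intertwining (YI : M1 -> int -> M2 -> M3) : Prop := {
  io_linear_l : forall n m2, linear (fun m1 => YI m1 n m2);
  io_linear_r : forall m1 n, linear (YI m1 n);
  io_degree : forall l1 l2 m1 m2 n,
    homog (@em_gr _ _ _ _ M1) l1 m1 -> homog (@em_gr _ _ _ _ M2) l2 m2 ->
    homog (@em_gr _ _ _ _ M3) (l1 + l2 - 1 - n%:~R) (YI m1 n m2);
  io_trunc : forall m1 m2, exists N : int, forall n, N <= n -> YI m1 n m2 = 0;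
  io_jacobi : forall (a : V) m1 m2 (l p q : int),
    has_sum (fun i : nat =>
      ((-1) ^+ i * zbinom k l i) *:
        em_mode a (p + l - i%:Z) (YI m1 (q + i%:Z) m2)
      - ((-1) ^ (l - i%:Z) * zbinom k l i) *:
        YI m1 (q + l - i%:Z) (em_mode a (p + i%:Z) m2)
      - ((-1) ^+ i * zbinom k (i%:Z - 1 - p) i) *:
        YI (em_mode a (l + i%:Z) m1) (p + q - i%:Z) m2) 0 }.

(* Phi(m1 (x) m2 (x) phi) = <phi, Y(m1,z) m2> *)
Definition equivalent_to (YI : M1 -> int -> M2 -> M3) (Phi : conformal_block)
    : Prop :=
  forall m1 m2 (phi : M3') (n : int),
    lcoef (Phi (coinv m1 m2 phi 1)) (-1 - n) = phi (YI m1 n m2).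

(* The group k^x acts on S by z |-> cz, hence on functions by f(z) |-> f(cz), and
   diagonally on (M1 (x) M2 (x) M3') (x) O_S; Phi commutes with these actions.
   A twist by f(z) |-> f(cz) on the source alone is not compatible with
   O_S-linearity unless Phi = 0. *)
Definition kx_equivariant (Phi : conformal_block) : Prop :=
  forall (c : k) (c0 : c != 0) m1 m2 (phi : M3') (f : OS),
    Phi (coinv (em_Pi (autO_scale c0) m1) (em_Pi (autO_scale c0) m2)
               (cg_scale c0 phi) (lscale c f))
    = lscale c (Phi (coinv m1 m2 phi f)).

End ConformalBlocks.
End Modules.

(* Main.v *)
(* Phi sends m1 (x) m2 (x) phi to <phi, Y(m1,z) m2>, which is a Laurent
   polynomial because phi lives in finitely many degrees and Y is graded. That it
   kills the action of a (x) t^i z^j (t-z)^l is the residue theorem, whose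
   coefficients of powers of z are exactly the Jacobi identity. For the
   equivariance, the multivalued powers x^{-l} do not matter: the existence of
   the representations of Aut O forces all degrees occurring in M1, M2, M3 to be
   integers, and then the claim is that m1_(n) m2 has degree
   deg m1 + deg m2 - 1 - n. *)
Require Import Defs.
From HB Require Import structures.
From mathcomp Require Import all_boot all_order all_algebra.
From mathcomp Require Import all_classical.
From mathcomp Require Import zify ring.
Set Implicit Arguments.
Unset Strict Implicit.
Unset Printing Implicit Defensive.
Import Order.TTheory GRing.Theory Num.Theory.
Local Open Scope ring_scope.

(** * Finitely supported sums *)

Lemma has_sum_seqE (I : choiceType) (W : zmodType) (F : I -> W) (s : W)
    (r : seq I) : has_sum F s -> uniq r -> (forall i, i \notin r -> F i = 0) ->
  s = \sum_(i <- r) F i.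
Proof.
(* Any duplicate-free list covering the support computes the same sum over the full index type, so
   two such lists are compared through it. *)
have fsE r0 : uniq r0 -> (forall i, i \notin r0 -> F i = 0) ->
    \sum_(i \in [set: I]) F i = \sum_(i <- r0) F i.
  move=> ur0 r0P; rewrite (fsbigE r0)//; last by move=> i _ /r0P.
  by apply: eq_bigl => i; rewrite in_setT.
move=> [r' [ur' r'P ->]] ur rP.
by rewrite -!fsE.
Qed.

Lemma has_sum_uniq (I : choiceType) (W : zmodType) (F : I -> W) (s t : W) :
  has_sum F s -> has_sum F t -> s = t.
Proof. by move=> Fs [r [ur rP ->]]; exact: has_sum_seqE. Qed.

Lemma eq_has_sum (I : eqType) (W : zmodType) (F G : I -> W) (s : W) :
  F =1 G -> has_sum F s -> has_sum G s.
Proof.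
move=> FG [r [ur rP ->]]; exists r; split=> // [i /rP|]; first by rewrite FG.
exact: eq_bigr.
Qed.

Lemma has_sumD (I : choiceType) (W : zmodType) (F G : I -> W) (s t : W) :
  has_sum F s -> has_sum G t -> has_sum (fun i => F i + G i) (s + t).
Proof.
move=> Fs Gt; have [r [_ rP _]] := Fs; have [r' [_ r'P _]] := Gt.
have P i : i \notin undup (r ++ r') -> F i = 0 /\ G i = 0.
  by rewrite mem_undup mem_cat negb_or => /andP[/rP-> /r'P->].
exists (undup (r ++ r')); split; first exact: undup_uniq.
  by move=> i /P[-> ->]; rewrite addr0.
rewrite big_split; congr (_ + _); apply: has_sum_seqE; rewrite ?undup_uniq//.
  by move=> i /P[].
by move=> i /P[].
Qed.

Lemma has_sum_additive (I : eqType) (U W : zmodType) (f : {additive U -> W})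
    (F : I -> U) (s : U) : has_sum F s -> has_sum (f \o F) (f s).
Proof.
move=> [r [ur rP ->]]; exists r; split=> // [i /rP /= ->|]; first exact: raddf0.
by rewrite raddf_sum.
Qed.

Lemma has_sumN (I : eqType) (W : zmodType) (F : I -> W) (s : W) :
  has_sum F s -> has_sum (fun i => - F i) (- s).
Proof. exact: (has_sum_additive (-%R)). Qed.

Lemma has_sum_eventually0 (W : zmodType) (F : nat -> W) (N : nat) :
  (forall e, (N <= e)%N -> F e = 0) -> exists s, has_sum F s.
Proof.
move=> F0; exists (\sum_(e <- iota 0 N) F e), (iota 0 N).
by split=> [|e|//]; rewrite ?iota_uniq// mem_iota add0n -leqNgt => /F0.
Qed.

Lemma has_sum_reindex (I J : eqType) (W : zmodType) (h : I -> J) (F : I -> W)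
    (G : J -> W) (s : W) : injective h -> (forall i, G (h i) = F i) ->
  (forall j, (forall i, j <> h i) -> G j = 0) -> has_sum F s -> has_sum G s.
Proof.
move=> hI GF G0 [r [ur rP ->]]; exists (map h r); split.
- by rewrite map_inj_uniq.
- move=> j jr; have [[i ji]|nj] := EM (exists i, j = h i).
    by rewrite ji GF rP//; apply: contra jr => ir; rewrite ji map_f.
  by apply: G0 => i ji; apply: nj; exists i.
- by rewrite big_map; apply: eq_bigr.
Qed.

(** Substitution n = l + e. The match on [n - l] has the shape of [iota_z_tz] and [iota_z_t], whose
    expansions start at a lowest exponent. *)
Lemma has_sum_up (W : zmodType) (F : nat -> W) (s : W) (l : int) :
  has_sum F s -> has_sum (fun n : int => if n - l is Posz e then F e else 0) s.
Proof.
apply: (@has_sum_reindex _ _ _ (fun e : nat => l + e%:Z)).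
- by move=> e e' /addrI[].
- by move=> e; rewrite (addrC l) addrK.
- move=> n nP; case E: (n - l) => [e|//].
  by case: (nP e); rewrite -E addrC subrK.
Qed.

(** Substitution n = l - e, for [iota_t_z], whose exponents descend from a highest one. *)
Lemma has_sum_down (W : zmodType) (F : nat -> W) (s : W) (l : int) :
  has_sum F s -> has_sum (fun n : int => if l - n is Posz e then F e else 0) s.
Proof.
apply: (@has_sum_reindex _ _ _ (fun e : nat => l - e%:Z)).
- by move=> e e' /addrI/oppr_inj[].
- by move=> e; rewrite subKr.
- move=> n nP; case E: (l - n) => [e|//].
  by case: (nP e); rewrite -E subKr.
Qed.

Lemma has_sum_sum0 (I : choiceType) (W : zmodType) (A : Type) (g : seq A)
    (F : A -> I -> W) : (forall x, has_sum (F x) 0) ->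
  has_sum (fun i => \sum_(x <- g) F x i) 0.
Proof.
move=> F0; elim: g => [|x g IHg].
  by exists [::]; split=> [||]//; rewrite ?big_nil// => i _; rewrite big_nil.
rewrite -[X in has_sum _ X]addr0; apply: eq_has_sum (has_sumD (F0 x) IHg) => i.
by rewrite big_cons.
Qed.

(** * Maps with a separate proof of linearity *)

Definition pack_linear (R : nzRingType) (U W : lmodType R) (f : U -> W)
    (fL : linear f) : {linear U -> W} :=
  HB.pack f (GRing.isLinear.Build R U W _ f fL).

Section RawLinear.
Variables (R : nzRingType) (U W : lmodType R) (f : U -> W) (fL : linear f).

Lemma linear_scale c u : f (c *: u) = c *: f u.
Proof. exact: (linearZZ (pack_linear fL)). Qed.

Lemma linear_add u v : f (u + v) = f u + f v.
Proof. exact: (raddfD (pack_linear fL)). Qed.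

Lemma linear_sub u v : f (u - v) = f u - f v.
Proof. exact: (raddfB (pack_linear fL)). Qed.

Lemma linear_0 : f 0 = 0.
Proof. exact: (raddf0 (pack_linear fL)). Qed.

Lemma linear_big (I : Type) (r : seq I) (F : I -> U) :
  f (\sum_(i <- r) F i) = \sum_(i <- r) f (F i).
Proof. exact: (raddf_sum (pack_linear fL)). Qed.

End RawLinear.

(** * Universal properties of free modules and of quotients by a span *)

Section FreeModuleLift.
Variables (T : choiceType) (R : comNzRingType) (U : lmodType R) (h : T -> U).

Definition fm_lift (x : freemod T R) : U :=
  \sum_(t \in [set: T]) (x t : R) *: h t.

Lemma fm_liftE (x : freemod T R) (r : seq T) : uniq r ->
  (forall t, t \notin r -> x t = 0) -> fm_lift x = \sum_(t <- r) (x t : R) *: h t.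
Proof.
move=> ur rP; rewrite /fm_lift (fsbigE r)//.
  by apply: eq_bigl => i; rewrite in_setT.
by move=> i _ /rP ->; rewrite scale0r.
Qed.

Lemma fm_lift_linear : linear fm_lift.
Proof.
move=> c x y.
have /asboolP[r rP] := fm_supp x; have /asboolP[s sP] := fm_supp y.
have P t : t \notin undup (r ++ s) -> x t = 0 /\ y t = 0.
  by rewrite mem_undup mem_cat negb_or => /andP[/rP-> /sP->].
have E t : (c *: x + y) t = c *: x t + y t by [].
rewrite !(@fm_liftE _ (undup (r ++ s))) ?undup_uniq//; last 3 first.
- by move=> t /P[].
- by move=> t /P[].
- by move=> t /P[xt yt]; rewrite E xt yt scaler0 addr0.
rewrite scaler_sumr -big_split; apply: eq_bigr => t _.
by rewrite E scalerDl scalerA.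
Qed.

Lemma fm_lift_gen (t : T) : fm_lift (fgen R t) = h t.
Proof.
rewrite (@fm_liftE _ [:: t])//; last first.
  by move=> u; rewrite inE /= => /negPf ->.
by rewrite big_seq1 /= eqxx scale1r.
Qed.

End FreeModuleLift.

Section QuotientLift.
Variables (R : comNzRingType) (U W : lmodType R) (G : set U).
Variables (f : {linear U -> W}) (fG : forall x, G x -> f x = 0).

(** Evaluates [f] on a chosen representative; independence of that choice rests on [fG] and is the
    content of [qliftE]. *)
Definition qlift (x : quot_span G) : W := f (repr x).

Lemma qliftE (x : U) : qlift (qproj G x) = f x.
Proof.
rewrite /qlift; apply/subr0_eq; rewrite -(raddfB f).
have : repr (qproj G x) - x \in span_of G by rewrite -qprojE qproj_surj.
move=> /asboolP[s [Gs ->]]; rewrite raddf_sum big_seq big1// => p /Gs Gp.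
by rewrite [LHS](linearZZ f) fG ?scaler0.
Qed.

Lemma qlift_linear : linear qlift.
Proof.
move=> c x y; rewrite -(qproj_surj x) -(qproj_surj y) -linearP !qliftE.
exact: linearP.
Qed.

End QuotientLift.

(** * Laurent polynomials and binomial coefficients *)

Section LaurentFacts.
Variable k : closedFieldType.
Implicit Types f g : laurent k.

Lemma lcoef0 n : lcoef (0 : laurent k) n = 0. Proof. by []. Qed.

Lemma lcoefB f g n : lcoef (f - g) n = lcoef f n - lcoef g n.
Proof. by []. Qed.

Lemma lcoef_sum (I : Type) (r : seq I) (F : I -> laurent k) n :
  lcoef (\sum_(i <- r) F i) n = \sum_(i <- r) lcoef (F i) n.
Proof. by elim/big_rec2: _ => // i x y _ <-; rewrite lcoefD. Qed.

Lemma lcoef_monoM c j f n : lcoef (lmono c j * f) n = c * lcoef f (n - j).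
Proof.
rewrite [LHS](@lconvE _ _ _ _ [:: j])// ?big_seq1 ?lcoef_mono ?eqxx//.
by move=> i; rewrite inE lcoef_mono => /negPf ->.
Qed.

Lemma lcoef_0M f n : lcoef (0 * f) n = 0.
Proof. by rewrite mul0r. Qed.

(** Each term of the convolution picks up c^i c^(n-i) = c^n; [c != 0] lets exponents add even when
    some are negative. *)
Lemma lscaleM c f g : c != 0 -> lscale c (f * g) = lscale c f * lscale c g.
Proof.
move=> c0; have [r [ur rP]] := lcoefP f; apply: laurentP => n.
rewrite [RHS](@lconvE _ _ _ _ r)//; last first.
  by move=> i /rP fi; rewrite /lcoef/= fi mulr0.
rewrite [LHS](_ : _ = c ^ n * lconv f g n)// (lconvE _ _ ur rP) mulr_sumr.
apply: eq_bigr => i _; rewrite /lcoef/=.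
by rewrite mulrACA -expfzDr// [i + _]addrC subrK.
Qed.

(** Reversing the product turns its factors into -(p - i). This brings the third binomial of the
    Jacobi identity to the form it has in the expansion of t^p around t = z. *)
Lemma zbinom_opp (p : int) (e : nat) :
  (-1) ^+ e * zbinom k (e%:Z - 1 - p) e = zbinom k p e.
Proof.
rewrite /zbinom /qbinom.
have -> : \prod_(i < e) ((e%:Z - 1 - p)%:~R - i%:R) =
          (-1) ^+ e * \prod_(i < e) (p%:~R - i%:R) :> rat.
  rewrite -[in (-1) ^+ e](card_ord e) -prodr_const -big_split/=.
  rewrite (reindex_inj rev_ord_inj)/=; apply: eq_bigr => i _.
  rewrite natrB// !rmorphB/= mulN1r -!pmulrn; ring.
(* In positive characteristic [ratr] is not additive, but negation only changes the sign of the
   numerator. *)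
have ratrN x : ratr (- x) = - ratr x :> k.
  by rewrite /ratr numqN denqN rmorphN mulNr.
rewrite -signr_odd -[in X in _ * X]signr_odd.
case: (odd e); last by rewrite !expr0 !mul1r.
by rewrite !expr1 !mulN1r mulNr ratrN opprK.
Qed.

End LaurentFacts.

(** * Roots of unity *)

Section RootsOfUnity.
Variable k : closedFieldType.

(** Take a root of 1 + X + ... + X^(d-1): this polynomial is nonconstant, divides X^d - 1, and takes
    the nonzero value d at 1. *)
Lemma nontrivial_unity_root (d : nat) : d%:R != 0 :> k -> (1 < d)%N ->
  exists2 x : k, x ^+ d = 1 & x != 1.
Proof.
move=> d0 d1; have d_gt0 := ltnW d1.
pose p : {poly k} := \poly_(i < d) 1.
have sp : size p = d by rewrite size_poly_eq ?oner_neq0.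
have pE x : p.[x] = \sum_(i < d) x ^+ i.
  by rewrite horner_poly; apply: eq_bigr => i _; rewrite mul1r.
have /closed_rootP[x /rootP px] : size p != 1%N by rewrite sp gtn_eqF.
exists x.
  by apply/subr0_eq; rewrite subrX1 -pE px mulr0.
apply: contraNneq d0 => x1; rewrite -px pE x1.
rewrite (eq_bigr (fun=> 1)); last by move=> i _; rewrite expr1n.
by rewrite sumr_const card_ord.
Qed.

Lemma coprime_unity_root (x : k) (m n : nat) : (0 < m)%N -> coprime m n ->
  x ^+ m = 1 -> x ^+ n = 1 -> x = 1.
Proof.
move=> m0 /eqP mn xm xn; have [d xd _] := prim_order_exists m0 xm.
have : (d %| gcdn m n)%N.
  by rewrite dvdn_gcd !(prim_order_dvd xd) xm xn eqxx.
by rewrite mn dvdn1 => /eqP d1; have := prim_expr_order xd; rewrite d1 expr1.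
Qed.

End RootsOfUnity.

(** * The automorphisms t -> x t and their action on equivariant modules *)

Section AutOScale.
Variable k : closedFieldType.

Lemma autO_eq (rho mu : autO k) : aut_ser rho =1 aut_ser mu -> rho = mu.
Proof.
case: rho mu => f fP [g gP] /= /funext fg; case: _ / fg gP => gP.
by congr AutO; exact: bool_irrelevance.
Qed.

Lemma autO_scaleM (x y : k) (x0 : x != 0) (y0 : y != 0) (xy0 : x * y != 0) :
  autO_mul (autO_scale x0) (autO_scale y0) = autO_scale xy0.
Proof.
apply: autO_eq => -[|m] /=; rewrite /ps_comp big_ord_recl /= mul0r add0r.
  by rewrite big_ord0.
rewrite big_ord_recl big1 ?addr0 => [|i _]; last by rewrite mul0r.
rewrite /= /ps_exp expr1 coef_poly ltnSn mulrC.
by case: eqP => // _; rewrite mul0r.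
Qed.

End AutOScale.

Section EquivariantModule.
Variables (k : closedFieldType) (V : vertexAlgebra k).
Variables (mo : moebiusStructure V) (ac : autOAction mo).
Variable M : equivariantModule ac.
Implicit Types (w : M) (c : k) (l : rat).

Local Notation gr := (@em_gr _ _ _ _ M).

Lemma em_gr_homog l w : homog gr l (gr l w).
Proof. by rewrite /homog (gr_proj (em_grading M)) eqxx. Qed.

(** Induction on [e] via c^(e+1) = c^e c. When c^e = 1 this ties the eigenvalue [y] to a root of
    unity, as the integrality of degrees requires. *)
Lemma em_Pi_scaleX c (c0 : c != 0) y w (e : nat) (ce0 : c ^+ e != 0) :
  em_Pi (autO_scale c0) w = y *: w ->
  em_Pi (autO_scale ce0) w = y ^+ e *: w.
Proof.
move=> cw; elim: e ce0 => [|e IHe] ce0.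
  have -> : autO_scale ce0 = autO_one k by apply: autO_eq.
  by rewrite (ar_one (em_rep M)) scale1r.
have cSe0 : c ^+ e * c != 0 by rewrite -exprSr.
have -> : autO_scale ce0 = autO_scale cSe0.
  by apply: autO_eq => i /=; rewrite exprSr.
rewrite -(autO_scaleM (expf_neq0 e c0) c0) (ar_mul (em_rep M)) cw.
have PL := ar_linear (em_rep M) (autO_scale (expf_neq0 e c0)).
by rewrite (linear_scale PL) IHe scalerA exprS.
Qed.

(* As Pi is a representation, x |-> x^{-l} is given on M_l by a homomorphism
   k^x -> k^x. Evaluating it at an x with x^d = 1, d = denq l, gives
   x^{numq l} = 1, hence x = 1; as d is invertible in k, this forces d = 1. *)
Lemma em_homog_int l w : homog gr l w -> w != 0 -> l \is a Num.int.
Proof.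
move=> lw w0; rewrite Qint_def; apply/negPn/negP => dn1.
have [d dE] : exists d : nat, denq (- l) = d.
  by exists `|denq (- l)|%N; rewrite absz_denq.
rewrite denqN in dE.
have d_gt0 : (0 < d)%N by have := denq_gt0 l; rewrite dE.
have d_gt1 : (1 < d)%N by rewrite ltn_neqAle d_gt0 eq_sym andbT -eqz_nat -dE.
have dk0 : d%:R != 0 :> k by have := em_denominators lw w0; rewrite dE.
have [x xd x1] := nontrivial_unity_root dk0 d_gt1.
have x0 : x != 0.
  by apply: contraNneq (oner_neq0 k) => x0; rewrite -xd x0 expr0n gtn_eqF.
have [y [yP yw]] := ar_scale (em_rep M) x0 l.
have xd0 : x ^+ d != 0 by rewrite expf_neq0.
have yd : y ^+ d = 1.
  have := em_Pi_scaleX xd0 (yw _ lw).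
  have -> : autO_scale xd0 = autO_one k.
    by apply: autO_eq => i /=; rewrite xd.
  rewrite (ar_one (em_rep M)) -{1}[w]scale1r => /eqP.
  rewrite -subr_eq0 -scalerBl scaler_eq0 (negPf w0) orbF subr_eq0.
  by move=> /eqP <-.
case/eqP: x1; apply: (@coprime_unity_root _ x d `|numq (- l)|%N) => //.
  have -> : d = `|denq (- l)|%N by rewrite denqN dE.
  by rewrite coprime_sym coprime_num_den.
move: yP; rewrite /is_rpow denqN dE -exprnP yd.
by case: (numq (- l)) => n; rewrite ?NegzE -?exprnN -?exprnP ?abszN //;
  move=> /esym/eqP; rewrite ?invr_eq1 => /eqP.
Qed.

(** In integral degree the exponent has denominator 1, so the unspecified value [y] of the power is
    determined. *)
Lemma em_Pi_scaleE c (c0 : c != 0) (z : int) w : homog gr z%:~R w ->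
  em_Pi (autO_scale c0) w = c ^ (- z) *: w.
Proof.
move=> zw; have [y [yP ->//]] := ar_scale (em_rep M) c0 z%:~R.
by move: yP; rewrite /is_rpow -rmorphN numq_int denq_int expr1z => ->.
Qed.

Lemma em_Pi_inv_linear rho : linear (@em_Pi_inv _ _ _ _ M rho).
Proof.
have [PK PVK] := ar_inv (em_rep M) rho.
by move=> c u v; apply: (can_inj PK); rewrite (ar_linear (em_rep M)) !PVK.
Qed.

Lemma em_Pi_inv_scaleE c (c0 : c != 0) (z : int) w : homog gr z%:~R w ->
  em_Pi_inv (autO_scale c0) w = c ^ z *: w.
Proof.
move=> zw; have [PK PVK] := ar_inv (em_rep M) (autO_scale c0).
apply: (can_inj PK); rewrite PVK.
have PL := ar_linear (em_rep M) (autO_scale c0).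
rewrite (linear_scale PL) (em_Pi_scaleE _ zw) scalerA.
by rewrite -expfzDr// subrr scale1r.
Qed.

Lemma em_mode_eventually0 (a : V) w (l : int) :
  exists N : nat, forall e, (N <= e)%N -> em_mode a (l + e%:Z) w = 0.
Proof.
have [N NP] := ma_trunc (em_action M) a w.
by exists `|N - l|%N => e Ne; apply: NP; lia.
Qed.

End EquivariantModule.

(** * The conformal block of an intertwining operator *)

Section IntertwiningBlock.
Variables (k : closedFieldType) (V : vertexAlgebra k).
Variables (mo : moebiusStructure V) (ac : autOAction mo).
Variables M1 M2 M3 : equivariantModule ac.
Variables (YI : M1 -> int -> M2 -> M3) (hYI : intertwining YI).
Implicit Types phi : contragredient M3.

(** The list is chosen before [n]: one finite set of bidegrees serves all modes, so the support can
    be bounded for all of them at once. *)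
Lemma YI_decomp m1 m2 : exists r : seq (rat * rat), forall n,
  YI m1 n m2 = \sum_(l <- r) YI (em_gr l.1 m1) n (em_gr l.2 m2).
Proof.
have [r1 [_ _ m1E]] := gr_sum (em_grading M1) m1.
have [r2 [_ _ m2E]] := gr_sum (em_grading M2) m2.
exists [seq (a, b) | a <- r1, b <- r2] => n.
rewrite big_allpairs_dep /= {1}m1E (linear_big (io_linear_l hYI n m2)).
apply: eq_bigr => a _.
by rewrite {1}m2E (linear_big (io_linear_r hYI _ n)).
Qed.

Lemma YI_coef_supp m1 m2 phi :
  (fun N : int => phi (YI m1 (-1 - N) m2) : k^o) \in @fin_supp int k.
Proof.
have /asboolP[_ [r3 r3P]] := cg_funP phi.
have [r rP] := YI_decomp m1 m2.
(* A component of bidegree [l] meets degree d of [phi] only if n = l.1 + l.2 - 1 - d, and N = -1 -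
   n. The floor turns this rational into an integer and is exact whenever such an n exists. *)
apply/asboolP; exists [seq -1 - Num.floor (l.1 + l.2 - 1 - d) | l <- r, d <- r3].
move=> N Nr; rewrite rP (linear_big (cg_linear phi)) big_seq big1// => l lr.
have hd := io_degree hYI (-1 - N) (em_gr_homog l.1 m1) (em_gr_homog l.2 m2).
rewrite -hd; apply: r3P; apply: contra Nr => dr.
apply/allpairsP; exists (l, l.1 + l.2 - 1 - (-1 - N)%:~R); split=> //=.
by rewrite subKr intrKfloor subKr.
Qed.

(* <phi, Y(m1,z) m2> *)
Definition YI_form (x : M1 * M2 * contragredient M3) : (laurent k)^o :=
  FreeMod (YI_coef_supp x.1.1 x.1.2 x.2).

Lemma lcoef_YI_form m1 m2 phi N :
  lcoef (YI_form (m1, m2, phi)) N = phi (YI m1 (-1 - N) m2).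
Proof. by []. Qed.

Lemma YI_form_trilinear x : trilinearity x -> fm_lift YI_form x = 0.
Proof.
pose L := pack_linear (fm_lift_linear YI_form).
have LE c u v w : L (u - lmono c 0 *: v - w) = L u - lmono c 0 * L v - L w.
  rewrite !raddfB; congr (_ - _ - _).
  exact: linear_scale (fm_lift_linear YI_form) _ _.
have Lg m1 m2 phi : L (triple m1 m2 phi) = YI_form (m1, m2, phi).
  exact: fm_lift_gen.
move=> [c [m1 [m1' [m2 [m2' [phi [phi' H]]]]]]].
(* All three kinds of relators map to some f - c g - h, so linearity in each slot can be checked on
   coefficients. *)
suff [f [g [h [-> fgh]]]] : exists f g h : laurent k,
    fm_lift YI_form x = f - lmono c 0 * g - h /\
    forall N, lcoef f N = c * lcoef g N + lcoef h N.
  apply: laurentP => N; rewrite !lcoefB lcoef_monoM subr0 fgh lcoef0; ring.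
case: H => ->; do 3 eexists; (split; [by rewrite [LHS]LE !Lg|]) => N;
  rewrite !lcoef_YI_form.
- by rewrite (io_linear_l hYI) cg_linear.
- by rewrite (io_linear_r hYI) cg_linear.
- by [].
Qed.

Definition tensor_form : tensor M1 M2 M3 -> (laurent k)^o :=
  qlift (G := @trilinearity _ _ _ _ M1 M2 M3)
    (pack_linear (fm_lift_linear YI_form)).

Lemma tensor_form_linear : linear tensor_form.
Proof. exact: (qlift_linear (f := pack_linear (fm_lift_linear YI_form))
  YI_form_trilinear). Qed.

Lemma tensor_formE m1 m2 phi f :
  tensor_form (tens m1 m2 phi f) = f * YI_form (m1, m2, phi).
Proof.
rewrite [LHS](qliftE (f := pack_linear (fm_lift_linear YI_form))
  YI_form_trilinear) [LHS](linear_scale (fm_lift_linear _)).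
by congr (_ *: _); exact: fm_lift_gen.
Qed.

(* Coefficient of z^N in the contribution of the n-th modes of a to the action
   of a (x) c t^i z^j (t-z)^l on m1 (x) m2 (x) phi. *)
Definition residue_term (a : V) (m1 : M1) (m2 : M2) phi (N : int)
    (x : k * int * int * int) (n : int) : k :=
  let: (c, i, j, l) := x in
  (if n - l is Posz e then
     c * zbinom k i e * phi (YI (em_mode a n m1) (-1 - (N - (i - e%:Z + j))) m2)
   else 0)
  + (if n - i is Posz e then
       c * (zbinom k l e * (-1) ^ (l - e%:Z)) *
         phi (YI m1 (-1 - (N - (j + l - e%:Z))) (em_mode a n m2))
     else 0)
  - (if i + l - n is Posz e then
       c * (zbinom k l e * (-1) ^+ e) *
         phi (em_mode a n (YI m1 (-1 - (N - (j + e%:Z))) m2))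
     else 0).

(* The residue theorem for <phi, Y(a,t) Y(m1,z) m2> t^i z^j (t-z)^l dt. *)
Lemma residue_sum a m1 m2 phi N x : has_sum (residue_term a m1 m2 phi N x) 0.
Proof.
(* Chosen so that z^j z^(-1-q) = z^N. Below, [T1], [T2], [T3] are the contributions of the points t
   = z, t = 0 and t = infinity. *)
case: x => [[[c i] j] l]; pose q := j - 1 - N.
pose T1 (e : nat) : k := c * zbinom k i e *
  phi (YI (em_mode a (l + e%:Z) m1) (i + q - e%:Z) m2).
pose T2 (e : nat) : k := c * (zbinom k l e * (-1) ^ (l - e%:Z)) *
  phi (YI m1 (q + l - e%:Z) (em_mode a (i + e%:Z) m2)).
pose T3 (e : nat) : k := c * (zbinom k l e * (-1) ^+ e) *
  phi (em_mode a (i + l - e%:Z) (YI m1 (q + e%:Z) m2)).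
have phi0 : phi 0 = 0 by exact: (linear_0 (cg_linear phi)).
(* The Jacobi identity sums the three families over a common index, whereas the action shifts each
   one differently. Truncation makes each family summable by itself, so they can be separated and
   reindexed. *)
have [s1 S1] : exists s, has_sum T1 s.
  have [B BP] := em_mode_eventually0 a m1 l.
  apply: (@has_sum_eventually0 _ _ B) => e /BP E.
  by rewrite /T1 E (linear_0 (io_linear_l hYI _ _)) phi0 mulr0.
have [s2 S2] : exists s, has_sum T2 s.
  have [B BP] := em_mode_eventually0 a m2 i.
  apply: (@has_sum_eventually0 _ _ B) => e /BP E.
  by rewrite /T2 E (linear_0 (io_linear_r hYI _ _)) phi0 mulr0.
have [s3 S3] : exists s, has_sum T3 s.
  have [B BP] := io_trunc hYI m1 m2.
  apply: (@has_sum_eventually0 _ _ `|B - q|%N) => e Be.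
  rewrite /T3 BP; last by lia.
  by rewrite (linear_0 (ma_linear_r (em_action M3) _ _)) phi0 mulr0.
pose F (w : M3) : k^o := c * phi w.
have FL : linear F.
  by move=> d u v; rewrite /F cg_linear mulrDr; congr (_ + _); exact: mulrCA.
have s0 : s3 - s2 - s1 = 0.
  apply: has_sum_uniq (has_sumD (has_sumD S3 (has_sumN S2)) (has_sumN S1)) _.
  (* The coefficient of x^(-1-i) y^(-1-l) z^(-1-q) is the residue against t^i (t-z)^l. *)
  have := has_sum_additive (pack_linear FL) (io_jacobi hYI a m1 m2 l i q).
  rewrite raddf0; apply: eq_has_sum => e; rewrite -[LHS]/(F _).
  rewrite zbinom_opp !(linear_sub FL) !(linear_scale FL) /F.
  rewrite /T1 /T2 /T3; congr (_ - _ - _).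
  - by rewrite [LHS]mulrCA mulrA (mulrC (zbinom _ _ _)).
  - by rewrite [LHS]mulrCA mulrA (mulrC (zbinom _ _ _)).
  - by rewrite [LHS]mulrCA mulrA.
have sE : s1 + s2 - s3 = 0 by rewrite -[RHS]oppr0 -s0 !opprB addrA.
rewrite -[X in has_sum _ X]sE.
apply: eq_has_sum (has_sumD (has_sumD (has_sum_up l S1) (has_sum_up i S2))
  (has_sumN (has_sum_down (i + l) S3))) => n.
congr (_ + _ - _).
- case E: (n - l) => [e|//]; rewrite /T1 -E [l + _]addrC subrK.
  by congr (_ * phi (YI _ _ _)); rewrite /q; ring.
- case E: (n - i) => [e|//]; rewrite /T2 -E [i + _]addrC subrK.
  by congr (_ * phi (YI _ _ _)); rewrite /q; ring.
- case E: (i + l - n) => [e|//]; rewrite /T3 -E subKr.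
  by congr (_ * phi (em_mode _ _ (YI _ _ _))); rewrite /q; ring.
Qed.

(** On the coefficient of z^N, the action of [g] splits into its monomials, and [residue_sum]
    handles each of them; uniqueness of finite sums concludes. *)
Lemma tensor_form_chiral x :
  (exists a g m1 m2 phi, @chiral_action _ _ _ _ M1 M2 M3 a g m1 m2 phi x) ->
  tensor_form x = 0.
Proof.
move=> [a [g [m1 [m2 [phi Hx]]]]]; apply: laurentP => N.
have lN : linear (fun f : laurent k => lcoef f N : k^o) by [].
have := has_sum_additive (pack_linear lN)
  (has_sum_additive (pack_linear tensor_form_linear) Hx).
move=> /has_sum_uniq; apply.
apply: eq_has_sum (has_sum_sum0 g (residue_sum a m1 m2 phi N)) => n.
rewrite -[RHS]/(lcoef (tensor_form _) N) (linear_sub tensor_form_linear).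
rewrite (linear_add tensor_form_linear) !tensor_formE.
rewrite lcoefB lcoefD /iota_z_tz /iota_z_t /iota_t_z !mulr_suml !lcoef_sum.
rewrite -big_split -sumrB; apply: eq_bigr => -[[[c i] j] l] _ /=.
congr (_ + _ - _).
- by case: (n - l) => e; [rewrite [RHS]lcoef_monoM|rewrite [RHS]lcoef_0M].
- by case: (n - i) => e; [rewrite [RHS]lcoef_monoM|rewrite [RHS]lcoef_0M].
- by case: (i + l - n) => e; [rewrite [RHS]lcoef_monoM|rewrite [RHS]lcoef_0M].
Qed.

Definition YI_block : conformal_block M1 M2 M3 :=
  pack_linear (qlift_linear (f := pack_linear tensor_form_linear)
    tensor_form_chiral).

Lemma YI_blockE m1 m2 phi f :
  YI_block (coinv m1 m2 phi f) = f * YI_form (m1, m2, phi).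
Proof. by rewrite [LHS](qliftE (f := pack_linear tensor_form_linear)
  tensor_form_chiral) [LHS]tensor_formE. Qed.

(** On vectors of integral degrees z1, z2 the three scalings contribute c^(-z1) c^(-z2)
    c^(z1+z2-1-n). General vectors follow by decomposing into components. *)
Lemma YI_scale (c : k) (c0 : c != 0) m1 m2 n :
  em_Pi_inv (autO_scale c0)
    (YI (em_Pi (autO_scale c0) m1) n (em_Pi (autO_scale c0) m2)) =
  c ^ (-1 - n) *: YI m1 n m2.
Proof.
have homogE l1 l2 u1 u2 : homog (@em_gr _ _ _ _ M1) l1 u1 ->
    homog (@em_gr _ _ _ _ M2) l2 u2 ->
    em_Pi_inv (autO_scale c0)
      (YI (em_Pi (autO_scale c0) u1) n (em_Pi (autO_scale c0) u2)) =
    c ^ (-1 - n) *: YI u1 n u2.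
  have P1 := ar_linear (em_rep M1) (autO_scale c0).
  have P2 := ar_linear (em_rep M2) (autO_scale c0).
  have P3 := @em_Pi_inv_linear _ _ _ _ M3 (autO_scale c0).
  (* Zero is homogeneous of every degree, so integrality of the degrees is available only for
     nonzero vectors. *)
  move=> h1 h2; have [->|u10] := eqVneq u1 0.
    rewrite (linear_0 P1) !(linear_0 (io_linear_l hYI _ _)) (linear_0 P3).
    by rewrite scaler0.
  have [->|u20] := eqVneq u2 0.
    rewrite (linear_0 P2) !(linear_0 (io_linear_r hYI _ _)) (linear_0 P3).
    by rewrite scaler0.
  have /intrP[z1 z1E] := em_homog_int h1 u10.
  have /intrP[z2 z2E] := em_homog_int h2 u20.
  have h3 := io_degree hYI n h1 h2.
  rewrite z1E in h1; rewrite z2E in h2.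
  have {}h3 : homog (@em_gr _ _ _ _ M3) (z1 + z2 - 1 - n)%:~R (YI u1 n u2).
    by rewrite !rmorphB rmorphD /= -z1E -z2E.
  rewrite (em_Pi_scaleE c0 h1) (em_Pi_scaleE c0 h2).
  rewrite (linear_scale (io_linear_l hYI _ _)).
  rewrite (linear_scale (io_linear_r hYI _ _)) !(linear_scale P3).
  rewrite (em_Pi_inv_scaleE c0 h3) !scalerA -!expfzDr//.
  by congr (c ^ _ *: _); ring.
have [r1 [_ _ m1E]] := gr_sum (em_grading M1) m1.
have [r2 [_ _ m2E]] := gr_sum (em_grading M2) m2.
rewrite m1E m2E (linear_big (ar_linear (em_rep M1) _)).
rewrite !(linear_big (io_linear_l hYI _ _))
  (linear_big (@em_Pi_inv_linear _ _ _ _ M3 _)).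
rewrite scaler_sumr; apply: eq_bigr => l1 _.
rewrite (linear_big (ar_linear (em_rep M2) _)).
rewrite !(linear_big (io_linear_r hYI _ _))
  (linear_big (@em_Pi_inv_linear _ _ _ _ M3 _)).
rewrite scaler_sumr; apply: eq_bigr => l2 _.
exact: homogE (em_gr_homog _ _) (em_gr_homog _ _).
Qed.

(** Since [lscale c] is multiplicative, f splits off; the remaining factor c^N is the one in
    [YI_scale] at n = -1 - N. *)
Lemma YI_block_equivariant : kx_equivariant YI_block.
Proof.
move=> c c0 m1 m2 phi f; rewrite !YI_blockE lscaleM//; congr (_ * _).
apply: laurentP => N; rewrite lcoef_YI_form /= YI_scale.
by rewrite (linear_scale (cg_linear phi)) subKr.
Qed.

End IntertwiningBlock.

Theorem theorem8p9 (k : closedFieldType) (V : vertexAlgebra k)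
    (mo : moebiusStructure V) (ac : autOAction mo)
    (M1 M2 M3 : equivariantModule ac)
    (adm1 : admissible M1) (adm2 : admissible M2) (adm3 : admissible M3)
    (fin3 : finite_dim_components M3)
    (YI : M1 -> int -> M2 -> M3) (hYI : intertwining YI) :
  exists Phi : conformal_block M1 M2 M3,
    equivalent_to YI Phi /\ kx_equivariant Phi.
Proof.
exists (YI_block hYI); split; last exact: YI_block_equivariant.
by move=> m1 m2 phi n; rewrite YI_blockE mul1r lcoef_YI_form subKr.
Qed.
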